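(* Let $f:\Omega\subseteq\mathbb C^k\to\mathbb R$ be twice-continuously $\mathbb R$-differentiable on the open convex set $\Omega$, and assume that $L^0_{\mathbb C^k}(f(\mathbf z(0)))$ is compact for $\mathbf z(0)\in\Omega$. Suppose that for all $\mathbf z\in\Omega$, $$\mathrm{Re}\{\mathbf h^*\mathcal H_{\mathbf z\mathbf z}(\mathbf z)\mathbf h+\mathbf h^*\mathcal H_{\overline{\mathbf z}\mathbf z}(\mathbf z)\overline{\mathbf h}\}>0\quad\text{for all nonzero }\mathbf h\in\mathbb C^k.$$ Assume $f$ has a unique stationary point $\hat{\mathbf z}\in L^0_{\mathbb C^k}(f(\mathbf z(0)))$, and fix $\epsilon\in(0,1]$. Consider the iteration $$\mathbf z(n+1)=\mathbf z(n)-\omega(n)\mu(n)\mathbf p(n),\qquad n=0,1,\dots,$$ where the $\mathbf p(n)=\mathbf p(\mathbf z(n))$ are the nonzero complex Newton updates $$\mathbf p(\mathbf z(n))=-\left[\mathcal H_{\mathbf z\mathbf z}-\mathcal H_{\overline{\mathbf z}\mathbf z}\mathcal H_{\overline{\mathbf z}\overline{\mathbf z}}^{-1}\mathcal H_{\mathbf z\overline{\mathbf z}}\right]^{-1}\left[\mathcal H_{\overline{\mathbf z}\mathbf z}\mathcal H_{\overline{\mathbf z}\overline{\mathbf z}}^{-1}\left(\frac{\partial f}{\partial\overline{\mathbf z}}\right)^*-\left(\frac{\partial f}{\partial\mathbf z}\right)^*\right]$$ (all Hessian matrices and gradients on the right being evaluated at $\mathbf z(n)$), the steplengths $\mu(n)$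 are given by $$\mu(n)=\frac{\mathrm{Re}\{\frac{\partial f}{\partial\mathbf z}(\mathbf z(n))\mathbf p(n)\}}{\mathrm{Re}\{\mathbf p(n)^*\mathcal H_{\mathbf z\mathbf z}(\mathbf z(n))\mathbf p(n)+\mathbf p(n)^*\mathcal H_{\overline{\mathbf z}\mathbf z}(\mathbf z(n))\overline{\mathbf p(n)}\}},$$ and the underrelaxation factors $\omega(n)$ satisfy $$0\le\epsilon\le\omega(n)\le\frac{2}{\gamma(n)}-\epsilon,$$ where, taking $\mathbf z=\mathbf z(n)$ and $\mathbf p=\mathbf p(n)$, $$\gamma(n)=\sup\left\{\frac{\mathrm{Re}\{\mathbf p^*\mathcal H_{\mathbf z\mathbf z}(\mathbf z-\mu\mathbf p)\mathbf p+\mathbf p^*\mathcal H_{\overline{\mathbf z}\mathbf z}(\mathbf z-\mu\mathbf p)\overline{\mathbf p}\}}{\mathrm{Re}\{\mathbf p^*\mathcal H_{\mathbf z\mathbf z}(\mathbf z)\mathbf p+\mathbf p^*\mathcal H_{\overline{\mathbf z}\mathbf z}(\mathbf z)\overline{\mathbf p}\}}\;:\;\mu>0,\ f(\mathbf z-\nu\mathbf p)<f(\mathbf z)\text{ for all }\nu\in(0,\mu]\right\}.$$ Then $\lim_{n\to\infty}\mathbf z(n)=\hat{\mathbf z}$, and the rate of convergence is at least R-linear.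
   Context: $\mathbb R$-differentiability. For $\Omega\subseteq\mathbb C^k$ put $D=\{(\mathbf x,\mathbf y)\in\mathbb R^{2k}:\mathbf x,\mathbf y\in\mathbb R^k,\ \mathbf x+i\mathbf y\in\Omega\}$. A function $f:\Omega\to\mathbb R$ is (twice-continuously) $\mathbb R$-differentiable if it is (twice-continuously) Fréchet differentiable as a function $f(\mathbf x,\mathbf y):D\subseteq\mathbb R^{2k}\to\mathbb R$. A stationary point of $f$ is a stationary point of $f(\mathbf x,\mathbf y)$ in this real sense. Derivatives. $\frac{\partial f}{\partial\mathbf z}$ and $\frac{\partial f}{\partial\overline{\mathbf z}}$ are the row vectors of Wirtinger derivatives $\frac{\partial}{\partial z_j}=\frac12\left(\frac{\partial}{\partial x_j}-i\frac{\partial}{\partial y_j}\right)$ and $\frac{\partial}{\partial\overline{z_j}}=\frac12\left(\frac{\partial}{\partial x_j}+i\frac{\partial}{\partial y_j}\right)$; $^*$ is conjugate transpose. The Hessian matrices are the Jacobian matrices $\mathcal H_{\mathbf z\mathbf z}=\frac{\partial}{\partial\mathbf z}\left(\frac{\partial f}{\partial\mathbf z}\right)^*$, $\mathcal H_{\overline{\mathbf z}\mathbf z}=\frac{\partial}{\partial\overline{\mathbf z}}\left(\frac{\partial f}{\partial\mathbf z}\right)^*$, $\mathcal H_{\mathbf z\overline{\mathbf z}}=\frac{\partial}{\partial\mathbf z}\left(\frac{\partial f}{\partial\overline{\mathbf z}}\right)^*$, $\mathcal H_{\overline{\mathbf z}\overline{\mathbf z}}=\frac{\partial}{\partial\overline{\mathbf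 z}}\left(\frac{\partial f}{\partial\overline{\mathbf z}}\right)^*$ (the $(j,l)$ entry of $\mathcal H_{\mathbf z\mathbf z}$ is the $\partial/\partial z_l$ derivative of the $j$-th component of $(\partial f/\partial\mathbf z)^*$, and similarly for the others). Level sets. For $\Omega$ open and $\mathbf z(0)\in\Omega$, $L_{\mathbb C^k}(f(\mathbf z(0)))=\{\mathbf z\in\Omega: f(\mathbf z)\le f(\mathbf z(0))\}$, and $L^0_{\mathbb C^k}(f(\mathbf z(0)))$ is the path-connected component of this set containing $\mathbf z(0)$. In the definition of $\gamma(n)$, the condition $f(\mathbf z-\nu\mathbf p)<f(\mathbf z)$ is understood to include $\mathbf z-\nu\mathbf p\in\Omega$. Rate of convergence. For a sequence $\{\mathbf z(n)\}\subseteq\mathbb C^k$ converging to $\hat{\mathbf z}$, let $R_1\{\mathbf z(n)\}=\limsup_{n\to\infty}\|\mathbf z(n)-\hat{\mathbf z}\|_{\mathbb C^k}^{1/n}$ (Euclidean norm). The rate of convergence is at least R-linear if $R_1\{\mathbf z(n)\}<1$. *)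

(* Defs.v *)
From mathcomp Require Import all_boot all_order all_algebra.
From mathcomp Require Import complex.
From mathcomp Require Import all_classical all_reals all_analysis.

Set Implicit Arguments.
Unset Strict Implicit.
Unset Printing Implicit Defensive.

Import Order.TTheory GRing.Theory Num.Theory numFieldNormedType.Exports.

Local Open Scope complex_scope.
Local Open Scope classical_set_scope.
Local Open Scope ring_scope.

(* R[i] carries no canonical topology as a bare type; seen as a
   numClosedFieldType it inherits the one induced by its norm, and so do
   matrices over it. In its order 0 <= t <= 1 forces t to be real, so convex_set
   on an lmodType over Cplx R is convexity with real coefficients. *)
Definition Cplx (R : realType) : numClosedFieldType := R[i].

Definition adjmx (R : realType) (m n : nat) (A : 'M[Cplx R]_(m, n)) :
  'M[Cplx R]_(n, m) := map_mx Num.conj A^T.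

Section RealCoordinates.
Variables (R : realType) (k : nat).
Implicit Types (f : 'cV[Cplx R]_k -> R) (Omega : set 'cV[Cplx R]_k).

Definition cplx_of_real (v : 'rV[R]_(k + k)) : 'cV[Cplx R]_k :=
  \col_j (v 0 (lshift k j) +i* v 0 (rshift k j)).

Definition real_of_cplx (z : 'cV[Cplx R]_k) : 'rV[R]_(k + k) :=
  row_mx (\row_j complex.Re (z j 0)) (\row_j complex.Im (z j 0)).

(* Coordinates of the Frechet derivative DF(p) : R^n -> R; p |-> DF(p) is
   identified with the map p |-> gradient F p into R^n. *)
Definition gradient (n : nat) (F : 'rV[R]_n -> R) (p : 'rV[R]_n) : 'rV[R]_n :=
  \row_j ('d F p (delta_mx 0 j)).

Definition twice_cont_differentiable (n : nat) (D : set 'rV[R]_n)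
    (F : 'rV[R]_n -> R) : Prop :=
  [/\ forall p, D p -> differentiable F p,
      forall p, D p -> differentiable (gradient F) p &
      {within D, continuous (jacobian (gradient F))}].

Definition twice_cont_Rdifferentiable Omega f : Prop :=
  twice_cont_differentiable (cplx_of_real @^-1` Omega) (f \o cplx_of_real).

Definition stationary_point f (z : 'cV[Cplx R]_k) : Prop :=
  is_diff (real_of_cplx z) (f \o cplx_of_real) (cst 0).

End RealCoordinates.

Section Wirtinger.
Variables (R : realType) (k : nat).
Local Notation C := (Cplx R).
Implicit Types (g : 'cV[C]_k -> C) (G : 'cV[C]_k -> 'cV[C]_k)
  (f : 'cV[C]_k -> R) (z p h : 'cV[C]_k) (j : 'I_k).

Definition real_derive (v : 'rV[R]_(k + k)) g z : C :=
  'D_v (fun u => complex.Re (g (cplx_of_real u))) (real_of_cplx z) +i*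
  'D_v (fun u => complex.Im (g (cplx_of_real u))) (real_of_cplx z).

Definition partial_x j g z : C := real_derive (delta_mx 0 (lshift k j)) g z.

Definition partial_y j g z : C := real_derive (delta_mx 0 (rshift k j)) g z.

Definition partial_z j g z : C :=
  2^-1 * (partial_x j g z - 'i * partial_y j g z).

Definition partial_zbar j g z : C :=
  2^-1 * (partial_x j g z + 'i * partial_y j g z).

Definition grad_z f z : 'rV[C]_k :=
  \row_j partial_z j (fun w => (f w)%:C) z.

Definition grad_zbar f z : 'rV[C]_k :=
  \row_j partial_zbar j (fun w => (f w)%:C) z.

Definition jacobian_z G z : 'M[C]_k :=
  \matrix_(j, l) partial_z l (fun w => G w j 0) z.

Definition jacobian_zbar G z : 'M[C]_k :=
  \matrix_(j, l) partial_zbar l (fun w => G w j 0) z.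

Definition hess_zz f : 'cV[C]_k -> 'M[C]_k :=
  jacobian_z (fun w => adjmx (grad_z f w)).

Definition hess_zbarz f : 'cV[C]_k -> 'M[C]_k :=
  jacobian_zbar (fun w => adjmx (grad_z f w)).

Definition hess_zzbar f : 'cV[C]_k -> 'M[C]_k :=
  jacobian_z (fun w => adjmx (grad_zbar f w)).

Definition hess_zbarzbar f : 'cV[C]_k -> 'M[C]_k :=
  jacobian_zbar (fun w => adjmx (grad_zbar f w)).

Definition hess_form f z h : R :=
  complex.Re ((adjmx h *m hess_zz f z *m h
    + adjmx h *m hess_zbarz f z *m map_mx Num.conj h) 0 0).

(* invmx is only meaningful on invertible matrices; positivity of hess_form at
   z makes both matrices inverted here invertible. *)
Definition newton_update f z : 'cV[C]_k :=
  - (invmx (hess_zz f z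
       - hess_zbarz f z *m invmx (hess_zbarzbar f z) *m hess_zzbar f z)
     *m (hess_zbarz f z *m invmx (hess_zbarzbar f z) *m adjmx (grad_zbar f z)
         - adjmx (grad_z f z))).

Definition steplength f z p : R :=
  complex.Re ((grad_z f z *m p) 0 0) / hess_form f z p.

(* sup is real-valued, with value 0 on empty or unbounded sets; with the
   convention x / 0 = 0, no omega satisfies 0 < eps <= omega <= 2 / 0 - eps, so
   the default value cannot validate the bound on the relaxation factors. *)
Definition relax_gamma (Omega : set 'cV[C]_k) f z p : R :=
  sup [set hess_form f (z - mu%:C *: p) p / hess_form f z p | mu in
    [set mu : R | 0 < mu /\ forall nu : R, 0 < nu <= mu ->
      Omega (z - nu%:C *: p) /\ f (z - nu%:C *: p) < f z]].

End Wirtinger.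

Definition path_component (R : realType) (T : topologicalType) (A : set T)
    (a : T) : set T :=
  [set b | exists g : R -> T,
    [/\ {within `[0, 1], continuous g}, g 0 = a, g 1 = b &
        forall t : R, 0 <= t <= 1 -> A (g t)]].

Section LevelSetsAndRates.
Variables (R : realType) (k : nat).
Local Notation C := (Cplx R).
Implicit Types (Omega : set 'cV[C]_k) (f : 'cV[C]_k -> R).

Definition level_set Omega f (z0 : 'cV[C]_k) : set 'cV[C]_k :=
  [set z | Omega z /\ f z <= f z0].

Definition level_component Omega f (z0 : 'cV[C]_k) : set 'cV[C]_k :=
  path_component R (level_set Omega f z0) z0.

Definition euclid_norm (z : 'cV[C]_k) : R :=
  Num.sqrt (\sum_j (complex.Re (z j 0) ^+ 2 + complex.Im (z j 0) ^+ 2)).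

(* The value of the root at n = 0 is irrelevant to the limsup. *)
Definition root_rate (z : nat -> 'cV[C]_k) (zhat : 'cV[C]_k) : \bar R :=
  limn_esup (fun n => (euclid_norm (z n - zhat) `^ (n%:R^-1))%:E).

Definition at_least_R_linear (z : nat -> 'cV[C]_k) (zhat : 'cV[C]_k) : Prop :=
  (root_rate z zhat < 1)%E.

End LevelSetsAndRates.

(* Main.v *)
Require Import Defs.
From mathcomp Require Import all_boot all_order all_algebra.
From mathcomp Require Import complex ring lra.
From mathcomp Require Import all_classical all_reals all_analysis.
Import Order.TTheory GRing.Theory Num.Theory numFieldNormedType.Exports.
Local Open Scope complex_scope.
Local Open Scope classical_set_scope.
Local Open Scope ring_scope.

Set Implicit Arguments.
Unset Strict Implicit.
Unset Printing Implicit Defensive.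

(** Everything is read on R^(2k). With F and H the objective and its Hessian in
    real coordinates, H h corresponds to twice H_zz h + H_zbarz conj(h)
    (hess_apply), so hess_form is half the real quadratic form of H
    (hess_formE), and the complex Newton update is exactly the solution of the
    real Newton equation H p = grad F (newton_updateP). This last point is block
    elimination: the equation for p and its conjugate form a 2 x 2 block system
    whose Schur complement is the matrix inverted in the update, and positivity
    of the form makes both the block and its Schur complement invertible
    (newton_system). As a consequence Re(grad_z f p) equals hess_form f z p, the
    steplength is always 1 (steplength_newton), and the iteration is the damped
    Newton method x - omega p.

    Since H is positive definite, F is strictly convex on the convex domain: the
    sublevel set L of the initial value is convex, hence equal to its path
    component, hence compact. On L compactness gives m |v|^2 <= H(v, v) and
    |H(u, v)| <= M |u| |v| with 0 < m. Along the ray x - t p let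
    c = H(p, p) = grad F . p. As long as F stays below F x the second derivative
    is at most gamma c, so F(x - t p) <= F x - c t (1 - gamma t / 2), which is
    below F x for t < 2 / gamma; hence the ray cannot come back to the level F x
    before 2 / gamma (stays_below), and the step omega in
    [eps, 2 / gamma - eps] decreases F by at least c eps^2 gamma / 2, a fixed
    multiple of |p|^2, because gamma >= m / M. Conversely strong convexity and
    |grad F . v| = |H(p, v)| <= M |p| |v| bound the gap F x - F xhat by
    M^2 |p|^2 / (2 m). So the gap shrinks by a fixed factor at each step, and
    (m / 2) |x - xhat|^2 <= F x - F xhat makes the iterates converge
    geometrically (damped_newton_geometric), which gives both the limit and the
    R-linear rate. *)

(** * Real vectors and Taylor estimates on a line *)

Section Dot.
Variables (R : realType) (n : nat).
Implicit Types u v : 'rV[R]_n.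
Definition dot u v : R := (u *m v^T) 0 0.

Lemma dotE u v : dot u v = \sum_j u 0 j * v 0 j.
Proof. by rewrite /dot mxE; apply: eq_bigr => j _; rewrite mxE. Qed.

Lemma dotC u v : dot u v = dot v u.
Proof. by rewrite !dotE; apply: eq_bigr => j _; rewrite mulrC. Qed.

Lemma dotZl a u v : dot (a *: u) v = a * dot u v.
Proof. by rewrite /dot -scalemxAl mxE. Qed.

Lemma dotNl u v : dot (- u) v = - dot u v.
Proof. by rewrite /dot mulNmx mxE. Qed.

Lemma dotZr a u v : dot u (a *: v) = a * dot u v.
Proof. by rewrite ![dot u _]dotC dotZl. Qed.

Lemma dotNr u v : dot u (- v) = - dot u v.
Proof. by rewrite ![dot u _]dotC dotNl. Qed.

Lemma dot0l v : dot 0 v = 0.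
Proof. by rewrite /dot mul0mx mxE. Qed.
End Dot.

Section Line.
Variable R : realType.

Lemma is_derive_line (V W : normedModType R) (f : V -> W) x v (t : R) :
  derivable f (x + t *: v) v ->
  is_derive t 1 (fun s : R => f (x + s *: v)) ('D_v f (x + t *: v)).
Proof.
move=> df.
have E : (fun h : R => h^-1 *: (f (x + (h *: (1:R) + t) *: v) - f (x + t *: v)))
  = (fun h : R => h^-1 *: (f (h *: v + (x + t *: v)) - f (x + t *: v))).
  apply/funext => h; rewrite scalerDl [h *: 1]mulr1.
  by rewrite addrCA.
split; first by rewrite /derivable /= E.
by rewrite /derive /= E.
Qed.

Lemma derive_dotr (V : normedModType R) n (g : V -> 'rV[R]_n) (a : 'rV[R]_n) x v :
  derivable g x v -> is_derive x v (fun y => dot (g y) a) (dot ('D_v g x) a).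
Proof.
move=> dg.
have E : (fun y => dot (g y) a) = \sum_j (a 0 j \*: (fun y => g y 0 j : R^o)).
  by apply/funext => y; rewrite dotE fct_sumE; apply: eq_bigr => j _; rewrite mulrC.
have /derivable_mxP dgj := dg.
rewrite E dotE derive_mx//.
have dj j := derivableP (dgj 0 j).
have -> : \sum_j (\matrix_(i, j0) 'D_v (fun t => g t i j0) x : 'rV_n) 0 j * a 0 j =
    \sum_j (a 0 j *: 'D_v (fun y => g y 0 j : R^o) x).
  by apply: eq_bigr => j _; rewrite mxE [RHS]mulrC.
by apply: is_derive_sum => j; apply: is_deriveZ.
Qed.

(** The bound on the second derivative is assumed on the open interval only:
    along a descent ray it is known strictly before the endpoint, where the
    objective may have come back to its initial value. *)
Lemma taylor2_le (g g1 g2 : R -> R) (T K : R) : 0 <= T ->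
  (forall t, 0 <= t <= T -> is_derive t 1 g (g1 t)) ->
  (forall t, 0 <= t <= T -> is_derive t 1 g1 (g2 t)) ->
  (forall t, 0 < t < T -> g2 t <= K) ->
  g T <= g 0 + g1 0 * T + K / 2 * T ^+ 2.
Proof.
move=> T0 dg dg1 g2K.
have within (h h' : R -> R) (s : R) : s <= T ->
    (forall t, 0 <= t <= T -> is_derive t 1 h (h' t)) ->
    {within `[0, s], continuous h}.
  move=> sT dh; apply: derivable_within_continuous => t; rewrite in_itv /=.
  case/andP=> t0 ts; apply: (@ex_derive _ _ _ _ _ _ _ (dh t _)).
  by rewrite t0 (le_trans ts).
have slope t : 0 <= t <= T -> g1 t <= g1 0 + K * t.
  case/andP; rewrite le_eqVlt => /predU1P[<- _|t0 tT]; first by rewrite mulr0 addr0.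
  have dg1' x : x \in `]0, t[%R -> is_derive x 1 g1 (g2 x).
    rewrite in_itv /= => /andP[x0 xt]; apply: dg1.
    by rewrite (ltW x0) (le_trans (ltW xt)).
  have [c] := MVT t0 dg1' (within _ _ _ tT dg1).
  rewrite in_itv /= subr0 => /andP[c0 ct] E.
  rewrite -lerBlDl E ler_pM2r // g2K // c0 /=; exact: lt_le_trans tT.
move: T0; rewrite le_eqVlt => /predU1P[<-|T0]; first by rewrite expr0n /= !mulr0 !addr0.
(* g minus its quadratic majorant; its slope is nonpositive *)
pose h := g - (fun t => g1 0 * t + K / 2 * t ^+ 2).
have dh t : 0 <= t <= T -> is_derive t 1 h (g1 t - (g1 0 + K * t)).
  move=> tT; have ? := dg t tT.
  have -> : h = g - (g1 0 \*: (id : R -> R^o) + K / 2 \*: ((id : R -> R^o) ^+ 2)).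
    by [].
  apply: is_derive_eq; rewrite /= /GRing.scale /=; by field.
have dh' x : x \in `]0, T[%R -> is_derive x 1 h (g1 x - (g1 0 + K * x)).
  by rewrite in_itv /= => /andP[x0 xt]; apply: dh; rewrite !ltW.
have [c] := MVT T0 dh' (within _ _ _ (lexx T) dh).
rewrite in_itv /= subr0 => /andP[c0 cT] E.
suff : h T - h 0 <= 0.
  rewrite /h !fctE expr0n /= !mulr0 addr0 oppr0 addr0 => ?; lra.
rewrite E pmulr_lle0 // subr_le0 slope // !ltW //.
Qed.

Lemma taylor2_ge (g g1 g2 : R -> R) (T K : R) : 0 <= T ->
  (forall t, 0 <= t <= T -> is_derive t 1 g (g1 t)) ->
  (forall t, 0 <= t <= T -> is_derive t 1 g1 (g2 t)) ->
  (forall t, 0 < t < T -> K <= g2 t) ->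
  g 0 + g1 0 * T + K / 2 * T ^+ 2 <= g T.
Proof.
move=> T0 dg dg1 Kg2.
have := @taylor2_le (- g) (- g1) (- g2) T (- K) T0 _ _ _.
rewrite !fctE => H.
suff : - g T <= - g 0 + - g1 0 * T + - K / 2 * T ^+ 2 by lra.
apply: H => t tT.
- by have ? := dg t tT; apply: is_deriveN.
- by have ? := dg1 t tT; apply: is_deriveN.
- by rewrite lerN2 Kg2.
Qed.
End Line.

(** * The real Hessian form and its bounds on compact sets *)

Section RealHessian.
Variables (R : realType) (n : nat).
Implicit Types (F : 'rV[R]_n -> R) (D : set 'rV[R]_n) (x v d : 'rV[R]_n).

Definition real_hess_form F x v : R := dot (v *m jacobian (gradient F) x) v.

Lemma real_hess_formZ F x a v : real_hess_form F x (a *: v) = a ^+ 2 * real_hess_form F x v.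
Proof. by rewrite /real_hess_form -scalemxAl dotZl dotZr mulrA. Qed.

Lemma real_hess_form0 F x : real_hess_form F x 0 = 0.
Proof. by rewrite /real_hess_form mul0mx dot0l. Qed.

Lemma real_hess_formN F x v : real_hess_form F x (- v) = real_hess_form F x v.
Proof. by rewrite -scaleN1r real_hess_formZ sqrrN expr1n mul1r. Qed.

Lemma derive_gradient F x v : differentiable F x -> 'D_v F x = dot (gradient F x) v.
Proof.
move=> dF; rewrite deriveE // {1}(row_sum_delta v) linear_sum dotE.
by apply: eq_bigr => j _; rewrite linearZ mxE [RHS]mulrC.
Qed.

Lemma is_derive_line1 F x v t : differentiable F (x + t *: v) ->
  is_derive t 1 (fun s : R => F (x + s *: v)) (dot (gradient F (x + t *: v)) v).
Proof.
move=> dF; rewrite -derive_gradient //; apply: is_derive_line.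
exact: diff_derivable.
Qed.

Lemma is_derive_line2 F x v t : differentiable (gradient F) (x + t *: v) ->
  is_derive t 1 (fun s : R => dot (gradient F (x + s *: v)) v)
    (real_hess_form F (x + t *: v) v).
Proof.
move=> dG; have /is_derive_line[dl El] : derivable (gradient F) (x + t *: v) v.
  exact: diff_derivable.
have -> : real_hess_form F (x + t *: v) v =
  dot ('D_1 (fun s : R => gradient F (x + s *: v)) t) v.
  by rewrite El deriveEjacobian.
exact: derive_dotr.
Qed.

Section Taylor.
Variables (D : set 'rV[R]_n) (F : 'rV[R]_n -> R).
Hypothesis F2 : twice_cont_differentiable D F.

Lemma taylor_segment_le x d (T K : R) : 0 <= T ->
  (forall t, 0 <= t <= T -> D (x + t *: d)) ->
  (forall t, 0 < t < T -> real_hess_form F (x + t *: d) d <= K) ->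
  F (x + T *: d) <= F x + dot (gradient F x) d * T + K / 2 * T ^+ 2.
Proof.
case: F2 => d1 d2 _ T0 DT hK.
have := taylor2_le T0 (fun t tT => is_derive_line1 (d1 _ (DT t tT)))
  (fun t tT => is_derive_line2 (d2 _ (DT t tT))) hK.
by rewrite scale0r addr0.
Qed.

Lemma taylor_segment_ge x d (T K : R) : 0 <= T ->
  (forall t, 0 <= t <= T -> D (x + t *: d)) ->
  (forall t, 0 < t < T -> K <= real_hess_form F (x + t *: d) d) ->
  F x + dot (gradient F x) d * T + K / 2 * T ^+ 2 <= F (x + T *: d).
Proof.
case: F2 => d1 d2 _ T0 DT hK.
have := taylor2_ge T0 (fun t tT => is_derive_line1 (d1 _ (DT t tT)))
  (fun t tT => is_derive_line2 (d2 _ (DT t tT))) hK.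
by rewrite scale0r addr0.
Qed.
End Taylor.

Lemma continuous_line x d : continuous (fun t : R => x + t *: d).
Proof.
move=> t; apply: cvgD; first exact: cvg_cst.
by apply: cvgZr_tmp; exact: cvg_id.
Qed.

Lemma near_right_lt (g : R -> R) (a : R) : is_derive (0 : R) 1 g a -> a < 0 ->
  exists2 e, 0 < e & forall t, 0 < t < e -> g t < g 0.
Proof.
case=> dg Eg a0; have cg : (fun h : R => h^-1 * (g (h * 1 + 0) - g 0)) @ 0^' --> a.
  by rewrite -Eg; exact: dg.
have [e /= e0 He] := cvgr_lt _ cg _ a0.
exists e => // t /andP[t0 te].
have := He t; rewrite /ball_ /= sub0r normrN gtr0_norm // => /(_ te).
rewrite gt_eqF // => /(_ isT); rewrite addr0 mulr1.
by rewrite [_ * (_ - _)]mulrC ltr_pdivrMr // mul0r subr_lt0.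
Qed.

Lemma entry_le_norm m k (A : 'M[R]_(m, k)) i j : `|A i j| <= `|A|.
Proof.
rewrite [leRHS]/Num.norm /= mx_normrE.
exact: (le_bigmax _ (fun ij : 'I_m * 'I_k => `|A ij.1 ij.2|) (i, j)).
Qed.

Lemma dot_mul_le (A : 'M[R]_n) u v :
  `|dot (u *m A) v| <= (n * n)%:R * `|A| * `|u| * `|v|.
Proof.
rewrite dotE; apply: le_trans (ler_norm_sum _ _ _) _.
have -> : (n * n)%:R * `|A| * `|u| * `|v| =
   \sum_(j < n) (\sum_(i < n) `|A| * `|u| * `|v|).
  by rewrite !sumr_const card_ord -mulrnA -[RHS]mulr_natl !mulrA.
apply: ler_sum => j _; rewrite mxE mulr_suml.
apply: le_trans (ler_norm_sum _ _ _) _; apply: ler_sum => i _.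
rewrite !normrM ler_pM ?mulr_ge0 ?entry_le_norm // [leRHS]mulrC.
by rewrite ler_pM ?entry_le_norm.
Qed.

Lemma sum_continuous_at (T : topologicalType) k (f : 'I_k -> T -> R) (x : T) :
  (forall i, {for x, continuous (f i)}) ->
  {for x, continuous (fun y => \sum_i f i y)}.
Proof.
move=> cf.
have -> : (fun y => \sum_i f i y) = \sum_i f i by apply/funext => y; rewrite fct_sumE.
elim/big_ind: _ => [|g h cg ch|i _]; [exact: cvg_cst|exact: cvgD|exact: cf].
Qed.

Section Compactness.
Variables (D L : set 'rV[R]_n) (F : 'rV[R]_n -> R).
Hypothesis (F2 : twice_cont_differentiable D F) (oD : open D).
Hypothesis (LD : L `<=` D) (cL : compact L).

(** On an open set, continuity within the set is continuity at each point. *)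
Lemma jacobian_continuous x : D x -> {for x, continuous (jacobian (gradient F))}.
Proof.
case: F2 => _ _ + Dx; rewrite continuous_open_subspace // => H.
by apply: H; rewrite inE.
Qed.

Lemma hess_bilinear_bounded : exists2 M : R, 0 < M &
  forall x u v, L x -> `|dot (u *m jacobian (gradient F) x) v| <= M * `|u| * `|v|.
Proof.
have cJ : {within L, continuous (jacobian (gradient F))}.
  by apply: continuous_in_subspaceT => x /set_mem /LD; exact: jacobian_continuous.
have /compact_bounded/ex_strict_bound_gt0[B B0 HB] := continuous_compact cJ cL.
exists ((n * n)%:R * B + 1); first by rewrite ltr_wpDl // mulr_ge0 // ltW.
move=> x u v Lx; apply: le_trans (dot_mul_le _ _ _) _.
rewrite !ler_wpM2r //; apply: ler_wpDr => //; apply: ler_wpM2l => //.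
by apply/ltW/HB; exists x.
Qed.

(** The form is continuous in (point, direction) and positive on the compact set
    L x unit sphere, so it attains a positive minimum there; homogeneity extends
    the bound to all directions. *)
Lemma hess_coercive : (forall x v, L x -> v != 0 -> 0 < real_hess_form F x v) ->
  exists2 m : R, 0 < m & forall x v, L x -> m * `|v| ^+ 2 <= real_hess_form F x v.
Proof.
move=> pos; pose S := [set v : 'rV[R]_n | `|v| = 1].
have cS : compact S.
  apply: bounded_closed_compact.
    exists 1; split => // M M1 v /= ->; exact: ltW.
  have -> : S = (fun v : 'rV[R]_n => `|v|) @^-1` [set 1] by [].
  by apply: closed_comp => //; move=> v _; exact: norm_continuous.
(* without points in L or without unit vectors, any constant works *)
have [[c LSc]|LS0] := pselect (exists c, (L `*` S) c); last first.
  exists 1 => // x v Lx; have [->|v0] := eqVneq v 0.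
    by rewrite normr0 expr0n /= mulr0 real_hess_form0.
  exfalso; apply: LS0; exists (x, `|v|^-1 *: v); split => //=.
  by rewrite /S /= normrZ normfV normr_id mulVf // normr_eq0.
pose f (q : 'rV[R]_n * 'rV[R]_n) : R := real_hess_form F q.1 q.2.
have cf : {within L `*` S, continuous f}.
  apply: continuous_in_subspaceT => -[x v] /set_mem[/= Lx Sv].
  have -> : f = fun q => \sum_j (\sum_i q.2 0 i * jacobian (gradient F) q.1 i j) * q.2 0 j.
    by apply/funext => q; rewrite /f /real_hess_form dotE; apply: eq_bigr => j _; rewrite mxE.
  have c2 i : {for (x, v), continuous (fun q : 'rV[R]_n * 'rV[R]_n => q.2 0 i : R)}.
    apply: (@continuous_comp _ _ _ snd (fun v : 'rV[R]_n => v 0 i)); first exact: cvg_snd.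
    exact: coord_continuous.
  have c1 i j : {for (x, v), continuous (fun q : 'rV[R]_n * 'rV[R]_n =>
      jacobian (gradient F) q.1 i j : R)}.
    apply: (@continuous_comp _ _ _ (fun q : 'rV[R]_n * 'rV[R]_n =>
       jacobian (gradient F) q.1) (fun A : 'M[R]_n => A i j)).
      apply: continuous_comp; first exact: cvg_fst.
      by apply: jacobian_continuous; exact: LD.
    exact: coord_continuous.
  apply: sum_continuous_at => j.
  apply: (@continuousM R _ (fun q : 'rV[R]_n * 'rV[R]_n => \sum_i _) _ (x, v)); last exact: c2.
  by apply: sum_continuous_at => i; apply: continuousM; [exact: c2|exact: c1].
have [[y w] /set_mem[/= Ly Sw] Hmin] :=
  compact_EVT_min (ex_intro _ c LSc) (compact_setX cL cS) cf.
have w0 : w != 0 by rewrite -normr_eq0 Sw oner_eq0.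
exists (real_hess_form F y w); first exact: pos.
move=> x v Lx; have [->|v0] := eqVneq v 0.
  by rewrite normr0 expr0n /= mulr0 real_hess_form0.
have nv0 : `|v| != 0 by rewrite normr_eq0.
have -> : real_hess_form F x v = real_hess_form F x (`|v|^-1 *: v) * `|v| ^+ 2.
  by rewrite -{1}[v](scalerK nv0) scalerA mulVf // scale1r real_hess_formZ; field.
rewrite ler_pM2r ?exprn_gt0 ?normr_gt0 //.
apply: (Hmin (x, `|v|^-1 *: v)); rewrite inE; split => //=.
by rewrite /S /= normrZ normfV normr_id mulVf.
Qed.
End Compactness.

End RealHessian.

(** * Rays along which the objective stays below its initial value *)

Section Descent.
Variables (R : realType) (n : nat).
Variables (D : set 'rV[R]_n) (F : 'rV[R]_n -> R).
Hypotheses (oD : open D) (F2 : twice_cont_differentiable D F).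

Definition below x d (t : R) := D (x + t *: d) /\ F (x + t *: d) < F x.

(** At t = 0 the strict decrease comes from the negative slope, and at t > 0
    from continuity; only in the second case is the value at t itself below. *)
Lemma below_persists x d (t c : R) : 0 <= t -> D x -> 
  dot (gradient F x) d = - c -> 0 < c -> (0 < t -> below x d t) ->
  exists2 e, 0 < e & forall s, t < s < t + e -> below x d s.
Proof.
case: F2 => dF _ _ t0 Dx dc c0 tb.
have Dt : D (x + t *: d).
  by move: t0; rewrite le_eqVlt => /predU1P[<-|/tb[]//]; rewrite scale0r addr0.
have dline s : D (x + s *: d) -> is_derive s 1 (fun s => F (x + s *: d))
    (dot (gradient F (x + s *: d)) d).
  by move=> Ds; apply: is_derive_line1; exact: dF.
have [e1 /= e10 H1] : \forall s \near t, D (x + s *: d).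
  by apply: (continuous_line (x := x) (d := d)); apply: open_nbhs_nbhs.
have [e2 e20 H2] : exists2 e, 0 < e &
    forall s, t < s < t + e -> F (x + s *: d) < F x.
  move: t0 tb Dt H1; rewrite le_eqVlt => /predU1P[<-|t0] tb Dt H1.
    have c0' : - c < 0 by rewrite oppr_lt0.
    have := dline _ Dt; rewrite [X in is_derive _ _ _ (dot (gradient F X) d)](_ : _ = x).
      rewrite dc => /near_right_lt/(_ c0')[e e0 He]; exists e => // s.
      by rewrite add0r => /He; rewrite scale0r addr0.
    by rewrite scale0r addr0.
  have ct : {for t, continuous (fun s : R => F (x + s *: d))}.
    apply: differentiable_continuous; apply/derivable1_diffP.
    exact: (@ex_derive _ _ _ _ _ _ _ (dline _ Dt)).
  have [e /= e0 He] := cvgr_lt _ ct _ (tb t0).2.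
  exists e => // s /andP[ts ste]; apply: He => /=.
  by rewrite ltr0_norm ?subr_lt0 // opprB; lra.
exists (Num.min e1 e2); first by rewrite lt_min e10.
move=> s /andP[ts]; rewrite -ltrBlDl lt_min => /andP[s1 s2]; split.
  by apply: H1 => /=; rewrite ltr0_norm ?subr_lt0 // opprB.
by apply: H2; rewrite ts -ltrBlDl.
Qed.

(** The curvature bound K is available only while the ray stays below F x, so
    this is a continuation argument on the last time T up to which it does. The
    closed sublevel set keeps x + T d in the domain; the Taylor bound
    F x - c T + K T^2 / 2 is still below F x at T because T < 2 c / K; and the
    property persists beyond T, so T cannot precede w. *)
Lemma stays_below x0 x d (c K w : R) :
  let L := [set y | D y /\ F y <= F x0] in
  closed L -> L x ->
  dot (gradient F x) d = - c -> 0 < c -> 0 <= K ->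
  (forall t, 0 < t -> (forall s, 0 < s <= t -> below x d s) ->
     real_hess_form F (x + t *: d) d <= K) ->
  0 < w -> K * w < 2 * c ->
  forall s, 0 < s <= w -> below x d s.
Proof.
move=> L clL [Dx Fx] dc c0 K0 HK w0 Kw.
pose S := [set t | 0 <= t <= w /\ forall s, 0 < s <= t -> below x d s].
have S0 : S 0.
  split; first by rewrite lexx ltW.
  by move=> s /andP[s0 s0']; move: (lt_le_trans s0 s0'); rewrite ltxx.
have Sub : ubound S w by move=> t [/andP[]].
have supS : has_sup S by split; [exists 0|exists w].
set T := sup S.
have T0 : 0 <= T by apply: ub_le_sup => //; exists w.
have Tw : T <= w by apply: ge_sup => //; exists 0.
have bT s : 0 < s < T -> below x d s.
  case/andP=> s0 sT; have sT' : 0 < T - s by rewrite subr_gt0.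
  have [t [_ St]] := sup_adherent sT' supS.
  rewrite opprB addrCA subrr addr0 => /ltW st; by apply: St; rewrite s0.
(* a limit of points of the closed set L *)
have LT : L (x + T *: d).
  move: T0; rewrite le_eqVlt => /predU1P[<-|T0]; first by rewrite scale0r addr0.
  apply: contrapT => nL.
  have [e /= e0 He] : \forall s \near T, (~` L) (x + s *: d).
    apply: (continuous_line (x := x) (d := d)); apply: open_nbhs_nbhs; split => //.
    exact: closed_openC.
  pose s := Num.max (T / 2) (T - e / 2).
  have sT : s < T by rewrite gt_max; apply/andP; split; lra.
  have s0 : 0 < s by rewrite lt_max; apply/orP; left; lra.
  have Ts : T - e / 2 <= s by rewrite le_max lexx orbT.
  case: (He s) => /=; first by rewrite gtr0_norm ?subr_gt0 //; lra.
  have /bT[Ds Fs] : 0 < s < T by rewrite s0.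
  by split => //; apply: ltW; apply: lt_le_trans Fx.
have Tb : 0 < T -> below x d T.
  move=> T0'; split; first by case: LT.
  apply: le_lt_trans (_ : F x + dot (gradient F x) d * T + K / 2 * T ^+ 2 < F x).
    apply: (taylor_segment_le F2) => //.
      move=> t /andP[]; rewrite le_eqVlt => /predU1P[<-|t0].
        by rewrite scale0r addr0.
      rewrite le_eqVlt => /predU1P[->|tT]; first by case: LT.
      by have /bT[] : 0 < t < T by rewrite t0.
    move=> t /andP[t0 tT]; apply: HK => // s /andP[s0 st].
    by apply: bT; rewrite s0 (le_lt_trans st).
  have : K * T < 2 * c by apply: le_lt_trans Kw; exact: ler_wpM2l.
  rewrite dc => KT; have : T * (K * T - 2 * c) < 0 by rewrite pmulr_rlt0 // subr_lt0.
  nra.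
have bT' s : 0 < s <= T -> below x d s.
  case/andP=> s0; rewrite le_eqVlt => /predU1P[sT|sT]; first by rewrite sT in s0 *; exact: Tb.
  by apply: bT; rewrite s0.
have <- : T = w => //.
apply/eqP; rewrite eq_le Tw /= leNgt; apply/negP => Tw'.
have [e e0 He] := below_persists T0 Dx dc c0 Tb.
pose t := Num.min w (T + e / 2).
have : t <= T.
  apply: ub_le_sup; first by exists w.
  split.
    rewrite ge_min lexx le_min (ltW w0) andbT /=.
    by rewrite addr_ge0 // divr_ge0 // ltW.
  move=> s /andP[s0]; rewrite le_min => /andP[sw sT].
  have [?|?] := leP s T; first by apply: bT'; rewrite s0.
  by apply: He; apply/andP; split => //; lra.
apply/negP; rewrite -ltNge lt_min Tw' /=; lra.
Qed.
End Descent.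

(** * Geometric convergence of the damped Newton method *)

Section Newton.
Variables (R : realType) (n : nat).
Variables (D : set 'rV[R]_n) (F : 'rV[R]_n -> R) (x0 : 'rV[R]_n).
Hypotheses (oD : open D) (F2 : twice_cont_differentiable D F).
Hypothesis cvxD : forall x y (t : R), D x -> D y -> 0 <= t <= 1 ->
  D (x + t *: (y - x)).
Hypothesis pos : forall x v, D x -> v != 0 -> 0 < real_hess_form F x v.
Let L := [set y | D y /\ F y <= F x0].

Lemma real_hess_form_ge0 x v : D x -> 0 <= real_hess_form F x v.
Proof.
move=> Dx; have [->|v0] := eqVneq v 0; first by rewrite real_hess_form0.
exact/ltW/pos.
Qed.

Lemma tangent_below (m : R) x y : D x -> D y ->
  (forall t, 0 < t < 1 ->
    m <= real_hess_form F (x + t *: (y - x)) (y - x)) ->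
  F x + dot (gradient F x) (y - x) + m / 2 <= F y.
Proof.
move=> Dx Dy Hm.
have := taylor_segment_ge F2 ler01 (fun t => @cvxD x y t Dx Dy) Hm.
by rewrite scale1r [x + _]addrC subrK expr1n !mulr1.
Qed.

(** Convexity of F from its tangents: with w = x + t (y - x), the tangent at w
    bounds F x and F y from below, and the weights 1 - t and t cancel the linear
    terms. *)
Lemma sublevel_convex x y (t : R) : L x -> L y -> 0 <= t <= 1 ->
  L (x + t *: (y - x)).
Proof.
move=> [Dx Fx] [Dy Fy] /andP[t0 t1].
set w := x + _; have Dw : D w by apply: cvxD => //; rewrite t0.
split => //.
have tg z : D z -> F w + dot (gradient F w) (z - w) <= F z.
  move=> Dz; have := @tangent_below 0 w z Dw Dz.
  rewrite mul0r addr0; apply=> s /andP[s0 s1]; apply: real_hess_form_ge0.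
  by apply: cvxD => //; rewrite !ltW.
have := tg _ Dx; have := tg _ Dy.
have -> : y - w = (1 - t) *: (y - x).
  by rewrite /w scalerBl scale1r opprD addrA.
have -> : x - w = (- t) *: (y - x) by rewrite /w opprD addrA subrr add0r scaleNr.
rewrite !dotZr; set a := dot _ _ => Hy Hx.
have Hy' : t * (F w + (1 - t) * a) <= t * F x0.
  by rewrite ler_wpM2l // (le_trans Hy).
have Hx' : (1 - t) * (F w + - t * a) <= (1 - t) * F x0.
  by rewrite ler_wpM2l ?subr_ge0 // (le_trans Hx).
lra.
Qed.

Hypothesis cL : compact L.

(** The hypotheses on the iterates are conditional on membership in D, which the
    descent argument establishes along with the decrease. The search
    direction is written - p so that the method moves along x + t d. *)
Theorem damped_newton_geometric (x p : nat -> 'rV[R]_n) xhat (eps : R)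
    (omega gamma : nat -> R) :
  x 0%N = x0 -> D x0 -> L xhat -> gradient F xhat = 0 -> 0 < eps ->
  (forall k, D (x k) -> p k *m jacobian (gradient F) (x k) = gradient F (x k)) ->
  (forall k, p k != 0) ->
  (forall k, D (x k) -> gamma k = sup
    [set real_hess_form F (x k + mu *: (- p k)) (- p k) / real_hess_form F (x k) (- p k) | mu in
      [set mu : R | 0 < mu /\ forall nu : R, 0 < nu <= mu ->
        below D F (x k) (- p k) nu]]) ->
  (forall k, eps <= omega k <= 2 / gamma k - eps) ->
  (forall k, D (x k) -> x k.+1 = x k + omega k *: (- p k)) ->
  exists C q : R, [/\ 0 <= C, 0 <= q < 1 &
    forall k, `|x k - xhat| <= C * q ^+ k].
Proof.
move=> x00 Dx0 Lhat ghat eps0 newton pn0 gammaE omegaP xS.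
have LD : L `<=` D by move=> y [].
have clL : closed L by apply: compact_closed cL; exact: norm_hausdorff.
have [M M0 HM] := hess_bilinear_bounded F2 oD LD cL.
have [m m0 Hm] := hess_coercive F2 oD LD cL (fun y v Ly => @pos y v (LD _ Ly)).
have HM2 y v : L y -> real_hess_form F y v <= M * `|v| ^+ 2.
  move=> Ly; rewrite expr2 mulrA; apply: le_trans (ler_norm _) _; exact: HM.
have sconv y z : L y -> L z ->
    F y + dot (gradient F y) (z - y) + m / 2 * `|z - y| ^+ 2 <= F z.
  move=> Ly Lz.
  have := @tangent_below (m * `|z - y| ^+ 2) y z (LD _ Ly) (LD _ Lz).
  rewrite mulrAC; apply=> t /andP[t0 t1]; apply: Hm.
  by apply: sublevel_convex => //; rewrite !ltW.
have grow y : L y -> m / 2 * `|y - xhat| ^+ 2 <= F y - F xhat.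
  move=> Ly; have := sconv _ _ Lhat Ly; rewrite ghat dot0l addr0; lra.
(* the relative decrease of the gap F x - F xhat guaranteed at each step *)
pose kappa := eps ^+ 2 * (m / M) ^+ 3.
have kappa0 : 0 < kappa by rewrite mulr_gt0 ?exprn_gt0 // divr_gt0.
have step k : L (x k) -> L (x k.+1) /\
    F (x k.+1) - F xhat <= (1 - kappa) * (F (x k) - F xhat).
  move=> Lx; set y := x k in Lx *; set d := - p k.
  have d0 : 0 < `|d| by rewrite normr_gt0 oppr_eq0 pn0.
  pose c := real_hess_form F y (p k).
  have c0 : 0 < c by apply: pos => //; exact: LD.
  have cE : real_hess_form F y d = c by rewrite real_hess_formN.
  have dE : dot (gradient F y) d = - c by rewrite /d dotNr -newton //; exact: LD.
  have mc : m * `|d| ^+ 2 <= c by rewrite -cE; exact: Hm.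
  have cM : c <= M * `|d| ^+ 2 by rewrite -cE; exact: HM2.
  have bL s : below D F y d s -> L (y + s *: d).
    by case=> Ds Fs; split => //; apply: ltW (lt_le_trans Fs _); case: Lx.
  have gE := gammaE k (LD _ Lx); rewrite -/y -/d in gE.
  set A := image _ _ in gE.
  have Aub : ubound A (M / m).
    move=> _ [s [s0 Hs] <-]; rewrite cE ler_pdivrMr //.
    have Ls : L (y + s *: d) by apply/bL/Hs; rewrite s0 lexx.
    apply: le_trans (HM2 _ _ Ls) _.
    by rewrite mulrAC ler_pdivlMr // -mulrA ler_wpM2l 1?mulrC // ltW.
  have [e e0 He] : exists2 e, 0 < e & forall s, 0 < s < 0 + e -> below D F y d s.
    apply: (below_persists oD F2 (lexx 0) (LD _ Lx) dE c0).
    by rewrite ltxx.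
  have A0 : A (real_hess_form F (y + (e / 2) *: d) d / real_hess_form F y d).
    exists (e / 2) => //; split; first by rewrite divr_gt0.
    by move=> s /andP[s0 se]; apply: He; rewrite s0 add0r /=; lra.
  have gub b : A b -> b <= gamma k.
    by move=> Ab; rewrite gE; apply: ub_le_sup => //; exists (M / m).
  (* any single admissible ratio already bounds the supremum from below *)
  have gm : m / M <= gamma k.
    apply: le_trans (gub _ A0); rewrite cE ler_pdivlMr // mulrAC ler_pdivrMr //.
    apply: le_trans (_ : m * (M * `|d| ^+ 2) <= _); first by rewrite ler_wpM2l // ltW.
    rewrite mulrCA [leRHS]mulrC ler_wpM2l ?(ltW M0) //; apply: Hm; apply/bL/He.
    rewrite add0r; lra.
  have g0 : 0 < gamma k by apply: lt_le_trans gm; rewrite divr_gt0.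
  have /andP[w1 w2] := omegaP k.
  have w0 : 0 < omega k by apply: lt_le_trans w1.
  have gw : gamma k * omega k <= 2 - gamma k * eps.
    have -> : 2 - gamma k * eps = gamma k * (2 / gamma k - eps).
      by rewrite mulrBr mulrCA divff ?mulr1 // gt_eqF.
    by rewrite ler_wpM2l // ltW.
  have K0 : 0 <= gamma k * c by rewrite mulr_ge0 // ltW.
  have HK t : 0 < t -> (forall s, 0 < s <= t -> below D F y d s) ->
      real_hess_form F (y + t *: d) d <= gamma k * c.
    move=> t0 Ht; rewrite -ler_pdivrMr // -cE; apply: gub.
    by exists t.
  have Kw : gamma k * c * omega k < 2 * c.
    have : c * (gamma k * omega k) < c * 2.
      rewrite ltr_pM2l //; apply: le_lt_trans gw _.
      by rewrite gtrBl mulr_gt0.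
    by rewrite mulrCA mulrA mulrC [c * 2]mulrC mulrC.
  have bw := stays_below oD F2 clL Lx dE c0 K0 HK w0 Kw.
  have xk : x k.+1 = y + omega k *: d by rewrite xS //; exact: LD.
  have bk : below D F y d (omega k) by apply: bw; rewrite w0 lexx.
  split; first by rewrite xk; exact: bL.
  have dec : F (x k.+1) <= F y - c * omega k + gamma k * c / 2 * omega k ^+ 2.
    rewrite xk -mulNr -dE; apply: (taylor_segment_le F2); first exact: ltW.
      move=> t /andP[]; rewrite le_eqVlt => /predU1P[<- _|t0 tw].
        by rewrite scale0r addr0; exact: LD.
      by have /bw[] : 0 < t <= omega k by rewrite t0.
    move=> t /andP[t0 tw]; apply: HK => // s /andP[s0 st].
    by apply: bw; rewrite s0 (le_trans st) // ltW.
  have dec2 : F (x k.+1) <= F y - c * (eps ^+ 2 * (m / M) / 2).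
    apply: le_trans dec _.
    have -> : F y - c * omega k + gamma k * c / 2 * omega k ^+ 2 =
      F y - c * (omega k * (2 - gamma k * omega k) / 2) by field.
    rewrite lerB // ler_pM2l // ler_pM2r ?invr_gt0 // expr2 -mulrA.
    apply: ler_pM => //; [exact: ltW| |].
      by rewrite mulr_ge0 // ?divr_ge0 // ltW.
    apply: le_trans (_ : gamma k * eps <= _); last by lra.
    by rewrite mulrC ler_wpM2r // ltW.
  (* maximizing M b a - m a^2 / 2 over the unknown distance a *)
  have gap : 2 * m * (F y - F xhat) <= M ^+ 2 * `|d| ^+ 2.
    have := sconv _ _ Lx Lhat.
    have := HM y (p k) (xhat - y) Lx; rewrite newton -/y; last exact: LD.
    move=> /ler_normlP[+ _].
    rewrite -[`|p k|]normrN -/d; set a := `|xhat - y|; set b := `|d|.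
    move=> H1 H2; have := sqr_ge0 (m * a - M * b).
    have : m * (F y - F xhat) <= m * (M * b * a - m / 2 * a ^+ 2).
      by rewrite ler_pM2l //; lra.
    rewrite !expr2; lra.
  have : m * `|d| ^+ 2 * (eps ^+ 2 * (m / M) / 2) <= c * (eps ^+ 2 * (m / M) / 2).
    by rewrite ler_wpM2r // divr_ge0 // mulr_ge0 ?sqr_ge0 // divr_ge0 ?ltW.
  have : kappa * (F y - F xhat) <= m * `|d| ^+ 2 * (eps ^+ 2 * (m / M) / 2).
    have -> : m * `|d| ^+ 2 * (eps ^+ 2 * (m / M) / 2) =
       (kappa / (2 * m)) * (M ^+ 2 * `|d| ^+ 2).
      rewrite /kappa; field; by rewrite !gt_eqF.
    have -> : kappa * (F y - F xhat) = kappa / (2 * m) * (2 * m * (F y - F xhat)).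
      field; by rewrite gt_eqF.
    have km : 0 < kappa / (2 * m) by rewrite divr_gt0 // mulr_gt0.
    by rewrite ler_wpM2l // ltW.
  move: dec2; lra.
have Lall k : L (x k).
  by elim: k => [|k /step[]//]; rewrite x00; split.
(* truncated at 0 so that its powers stay nonnegative *)
pose rho := Num.max 0 (1 - kappa).
have rho0 : 0 <= rho by rewrite le_max lexx.
have rho1 : rho < 1 by rewrite gt_max ltr01 gtrBl.
have decay k : F (x k) - F xhat <= (F x0 - F xhat) * rho ^+ k.
  elim: k => [|k IH]; first by rewrite x00 mulr1.
  apply: le_trans (step k (Lall k)).2 _.
  apply: le_trans (_ : rho * (F (x k) - F xhat) <= _).
    rewrite ler_wpM2r ?le_max ?lexx ?orbT //.
    by apply: le_trans (grow _ (Lall k)); rewrite mulr_ge0 ?sqr_ge0 // divr_ge0 // ltW.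
  by rewrite exprS mulrCA ler_wpM2l.
have E0 : 0 <= 2 / m * (F x0 - F xhat).
  rewrite mulr_ge0 ?divr_ge0 ?(ltW m0) //.
  rewrite -x00; apply: le_trans (grow _ (Lall 0%N)).
  by rewrite mulr_ge0 ?sqr_ge0 // divr_ge0 // ltW.
exists (Num.sqrt (2 / m * (F x0 - F xhat))), (Num.sqrt rho); split => //.
  by rewrite sqrtr_ge0 /= -sqrtr1 ltr_sqrt.
move=> k; rewrite -ler_sqr ?nnegrE ?mulr_ge0 ?exprn_ge0 ?sqrtr_ge0 //.
rewrite exprMn exprAC !sqr_sqrtr //.
have m2 : 0 < 2 / m by rewrite divr_gt0.
have -> : `|x k - xhat| ^+ 2 = 2 / m * (m / 2 * `|x k - xhat| ^+ 2).
  by field; rewrite gt_eqF.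
rewrite -[leRHS]mulrA ler_pM2l //; exact: le_trans (grow _ (Lall k)) (decay k).
Qed.
End Newton.

(** * The block system solved by the complex Newton update *)

Section SchurSystem.
Variables (R : realType) (k : nat).
Local Notation C := (Cplx R).
Local Notation cj := (map_mx (Num.conj : C -> C)).
Implicit Types (A B : 'M[C]_k) (g h v : 'cV[C]_k).

Lemma cjK m n (A : 'M[C]_(m, n)) : cj (cj A) = A.
Proof. by apply/matrixP => i j; rewrite !mxE conjCK. Qed.

Lemma cjZ m n (a : C) (A : 'M[C]_(m, n)) : cj (a *: A) = Num.conj a *: cj A.
Proof. by rewrite map_mxZ. Qed.

Lemma unitmx_of_ker (S : 'M[C]_k) :
  (forall v : 'cV_k, S *m v = 0 -> v = 0) -> S \in unitmx.
Proof.
move=> inj; rewrite -unitmx_tr -row_free_unit -kermx_eq0; apply/rowV0P => v.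
move/sub_kermxP => vS; apply: trmx_inj; rewrite trmx0; apply: inj.
by apply: trmx_inj; rewrite trmx_mul trmxK vS trmx0.
Qed.

Section Solve.
Variables A B : 'M[C]_k.
Hypothesis form_gt0 : forall h, h != 0 ->
  0 < complex.Re ((adjmx h *m A *m h + adjmx h *m B *m cj h) 0 0).

Let T h := A *m h + B *m cj h.

Lemma coupled_op_inj h : T h = 0 -> h = 0.
Proof.
move=> Th; apply/eqP/negPn/negP => /form_gt0.
by rewrite -!mulmxA -mulmxDr -/(T h) Th mulmx0 mxE ltxx.
Qed.

(** Multiplication by the imaginary unit turns A h - B conj(h) into
    A h + B conj(h), up to the factor i. *)
Lemma coupled_op_inj_conj h : A *m h = B *m cj h -> h = 0.
Proof.
move=> Th; suff /eqP : 'i *: h = 0.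
  by rewrite scaler_eq0 (negPf (neq0Ci _)) /= => /eqP.
by apply: coupled_op_inj; rewrite /T cjZ conjCi -!scalemxAr Th scaleNr subrr.
Qed.

(** If A h = 0, the form reduces to Re(h^* B conj(h)), which changes sign when h
    is replaced by i h. *)
Lemma positive_block_unit : A \in unitmx.
Proof.
apply: unitmx_of_ker => h Ah; apply/eqP/negPn/negP => h0.
have /form_gt0 : 'i *: h != 0 by rewrite scaler_eq0 negb_or neq0Ci.
have := form_gt0 h0.
have -> : adjmx ('i *: h) = - 'i *: adjmx h.
  by apply/matrixP => i j; rewrite !mxE rmorphM /= conjCi.
rewrite cjZ conjCi -!mulmxA -!scalemxAr Ah !mulmx0 scaler0 !add0r.
rewrite -scalemxAl scalerA mulrNN -expr2 sqrCi scaleN1r.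
set q : C := (adjmx h *m (B *m cj h)) 0 0.
have -> : (- (adjmx h *m (B *m cj h))) 0 0 = - q by rewrite mxE.
have -> : complex.Re (- q) = - complex.Re q by case: q.
by rewrite oppr_gt0 => H /(lt_trans H); rewrite ltxx.
Qed.

(** A kernel vector v extends to a solution (v, q) of the homogeneous block
    system with rows (A, B) and (conj B, conj A). Adding the first row to the
    conjugate of the second, and subtracting, gives v + conj q = 0 and
    v - conj q = 0 by injectivity of the coupled operator. *)
Lemma schur_complement_unit : A - B *m invmx (cj A) *m cj B \in unitmx.
Proof.
have uA := positive_block_unit.
have ucA : cj A \in unitmx by rewrite map_unitmx.
apply: unitmx_of_ker => v; rewrite mulmxBl => Sv.
pose q := - (invmx (cj A) *m (cj B *m v)).
have E1 : A *m v + B *m q = 0 by rewrite mulmxN !mulmxA.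
have E2 : cj B *m v + cj A *m q = 0 by rewrite mulmxN mulKVmx // subrr.
have E3 : B *m cj v + A *m cj q = 0.
  by apply: (can_inj (@cjK _ _)); rewrite map_mxD !map_mxM !cjK map_mx0.
have v1 : v + cj q = 0.
  apply: coupled_op_inj; rewrite /T map_mxD cjK !mulmxDr.
  by rewrite [B *m _ + _]addrC addrACA E1 add0r addrC.
have v2 : v - cj q = 0.
  apply: coupled_op_inj_conj; rewrite map_mxB cjK !mulmxBr.
  by apply/eqP; rewrite subr_eq addrAC eq_sym subr_eq E3 eq_sym; apply/eqP.
move/eqP: v2; rewrite subr_eq0 => /eqP v2.
move: v1; rewrite -v2 -mulr2n => /eqP; rewrite -scaler_nat scaler_eq0 pnatr_eq0 /=.
by move/eqP.
Qed.

(** Elimination of q from A p + B q = g, conj(B) p + conj(A) q = conj(g) gives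
    the formula for p. The system is invariant under (p, q) -> (conj q, conj p),
    so its solution satisfies q = conj p. *)
Lemma newton_system g :
  let p := - (invmx (A - B *m invmx (cj A) *m cj B) *m
              (B *m invmx (cj A) *m cj g - g)) in
  A *m p + B *m cj p = g.
Proof.
move=> p; have uS := schur_complement_unit; have uA := positive_block_unit.
have ucA : cj A \in unitmx by rewrite map_unitmx.
have Sp : (A - B *m invmx (cj A) *m cj B) *m p = g - B *m invmx (cj A) *m cj g.
  by rewrite /p mulmxN mulKVmx // opprB.
pose q := invmx (cj A) *m (cj g - cj B *m p).
have E1 : A *m p + B *m q = g.
  move: Sp; rewrite mulmxBl => /eqP; rewrite subr_eq => /eqP ->.
  rewrite /q !mulmxBr !mulmxA.
  by rewrite addrACA subrK subrr addr0.
have E2 : A *m cj q + B *m cj p = g.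
  apply: (can_inj (@cjK _ _)); rewrite map_mxD !map_mxM !cjK /q mulKVmx //.
  by rewrite subrK.
suff -> : cj p = q by [].
have : p - cj q = 0.
  apply: coupled_op_inj_conj; rewrite map_mxB cjK !mulmxBr.
  by apply/eqP; rewrite subr_eq addrAC eq_sym subr_eq E1 addrC E2.
by move/eqP; rewrite subr_eq0 => /eqP ->; rewrite cjK.
Qed.
End Solve.
End SchurSystem.

(** * Wirtinger calculus in real coordinates *)

Section CplxArith.
Variable R : realType.
Local Notation C := (Cplx R).

Lemma half_cplx : (2^-1 : C) = (2^-1 : R) +i* 0.
Proof. by have := fmorphV (real_complex R) 2; rewrite rmorph_nat => <-. Qed.

Lemma cplxD (a b c d : R) : ((a +i* b) + (c +i* d) : C) = (a + c) +i* (b + d).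
Proof. by []. Qed.

Lemma cplxM (a b c d : R) :
  ((a +i* b) * (c +i* d) : C) = (a * c - b * d) +i* (a * d + b * c).
Proof. by []. Qed.

Lemma cplx_conj (a b : R) : Num.conj (a +i* b : C) = a +i* (- b).
Proof. by []. Qed.

Lemma wirtinger_minus (a b c d : R) :
  (2^-1 * ((a +i* b) - 'i * (c +i* d)) : C) = ((a + d) / 2) +i* ((b - c) / 2).
Proof.
rewrite half_cplx; apply/eqP; rewrite eq_complex /=.
by apply/andP; split; apply/eqP; field.
Qed.

Lemma wirtinger_plus (a b c d : R) :
  (2^-1 * ((a +i* b) + 'i * (c +i* d)) : C) = ((a - d) / 2) +i* ((b + c) / 2).
Proof.
rewrite half_cplx; apply/eqP; rewrite eq_complex /=.
by apply/andP; split; apply/eqP; field.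
Qed.

Lemma cplx_sum k (a b : 'I_k -> R) :
  \sum_i (a i +i* b i : C) = (\sum_i a i) +i* (\sum_i b i).
Proof.
elim/big_ind3 : _ => // x1 x2 y z1 z2 w -> ->; exact: cplxD.
Qed.
End CplxArith.

Section Bridge.
Variables (R : realType) (k : nat).
Local Notation C := (Cplx R).
Local Notation cplx := (@cplx_of_real R k).
Local Notation real := (@real_of_cplx R k).
Implicit Types (u v : 'rV[R]_(k + k)) (z h : 'cV[C]_k).

Lemma cplx_of_realK : cancel cplx real.
Proof.
move=> v; apply/rowP => i; rewrite /real_of_cplx mxE.
by case: splitP => j ij; rewrite !mxE /=; congr (v 0 _); apply: val_inj.
Qed.

Lemma real_lshift z j : real z 0 (lshift k j) = complex.Re (z j 0).
Proof. by rewrite /real_of_cplx row_mxEl mxE. Qed.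

Lemma real_rshift z j : real z 0 (rshift k j) = complex.Im (z j 0).
Proof. by rewrite /real_of_cplx row_mxEr mxE. Qed.

Lemma real_of_cplxK : cancel real cplx.
Proof.
move=> z; apply/colP => j; rewrite mxE real_lshift real_rshift.
by case: (z j 0).
Qed.

Lemma real_of_cplxD z h : real (z + h) = real z + real h.
Proof.
apply/rowP => i; rewrite !mxE; case: splitP => j _; rewrite !mxE.
  by case: (z j 0) (h j 0) => ? ? [].
by case: (z j 0) (h j 0) => ? ? [].
Qed.

Lemma real_of_cplxZ (a : R) z : real (a%:C *: z) = a *: real z.
Proof.
apply/rowP => i; rewrite !mxE; case: splitP => j _; rewrite !mxE.
  by case: (z j 0) => ? ? /=; rewrite mul0r subr0.
by case: (z j 0) => ? ? /=; rewrite mul0r addr0.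
Qed.

Lemma real_of_cplxN z : real (- z) = - real z.
Proof.
apply/rowP => i; rewrite !mxE; case: splitP => j _; rewrite !mxE.
  by case: (z j 0).
by case: (z j 0).
Qed.

Lemma real_of_cplx_eq0 z : (real z == 0) = (z == 0).
Proof.
apply/eqP/eqP => [z0|->].
  by rewrite -[z]real_of_cplxK z0; apply/colP => j; rewrite !mxE.
by apply/rowP => i; rewrite !mxE; case: splitP => j _; rewrite !mxE.
Qed.

Lemma adjmxE m n (A : 'M[C]_(m, n)) i j : adjmx A i j = Num.conj (A j i).
Proof. by rewrite !mxE. Qed.

Lemma cplx_of_realZ (a : R) u j : cplx (a *: u) j 0 =
  (a * u 0 (lshift k j)) +i* (a * u 0 (rshift k j)).
Proof. by rewrite !mxE. Qed.

Lemma Re_adj_mul h u : complex.Re ((adjmx h *m cplx u) 0 0) = dot (real h) u.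
Proof.
rewrite dotE big_split_ord /= mxE.
have -> : \sum_j (adjmx h) 0 j * (cplx u) j 0 =
  \sum_j ((complex.Re (h j 0) * u 0 (lshift k j) +
           complex.Im (h j 0) * u 0 (rshift k j)) +i*
          (complex.Re (h j 0) * u 0 (rshift k j) -
           complex.Im (h j 0) * u 0 (lshift k j))).
  apply: eq_bigr => j _; rewrite !mxE; case: (h j 0) => a b /=.
  rewrite cplx_conj cplxM; by congr (_ +i* _); ring.
rewrite cplx_sum /= -big_split /=.
by apply: eq_bigr => j _; rewrite real_lshift real_rshift.
Qed.

Section AtPoint.
Variables (Omega : set 'cV[C]_k) (f : 'cV[C]_k -> R).
Local Notation F := (f \o cplx).
Local Notation D := (cplx @^-1` Omega).
Local Notation G := (gradient F).
Hypotheses (F2 : twice_cont_Rdifferentiable Omega f) (oD : open D).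

Lemma real_derive_real v z : Omega z ->
  real_derive v (fun w => (f w)%:C) z = (dot (G (real z)) v)%:C.
Proof.
move=> Oz; have [dF _ _] := F2.
rewrite /real_derive /= derive_cst -derive_gradient //; apply: dF.
by rewrite /= real_of_cplxK.
Qed.

Lemma dot_delta u j : dot u (delta_mx 0 j) = u 0 j.
Proof.
rewrite dotE (bigD1 j) //= mxE !eqxx mulr1 big1 ?addr0 // => i ij.
by rewrite mxE (negPf ij) andbF mulr0.
Qed.

Lemma grad_zE z j : Omega z -> grad_z f z 0 j =
  (G (real z) 0 (lshift k j) / 2) +i* (- (G (real z) 0 (rshift k j) / 2)).
Proof.
move=> Oz; rewrite mxE /partial_z /partial_x /partial_y !real_derive_real //.
by rewrite !dot_delta wirtinger_minus addr0 sub0r mulNr.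
Qed.

Lemma grad_zbarE z j : Omega z -> grad_zbar f z 0 j =
  (G (real z) 0 (lshift k j) / 2) +i* (G (real z) 0 (rshift k j) / 2).
Proof.
move=> Oz; rewrite mxE /partial_zbar /partial_x /partial_y !real_derive_real //.
by rewrite !dot_delta wirtinger_plus subr0 add0r.
Qed.

Lemma adj_grad_z z : Omega z -> adjmx (grad_z f z) = cplx (2^-1 *: G (real z)).
Proof.
move=> Oz; apply/colP => j; rewrite adjmxE cplx_of_realZ grad_zE //.
by rewrite cplx_conj opprK ![2^-1 * _]mulrC.
Qed.

Lemma adj_grad_zbar z : Omega z ->
  adjmx (grad_zbar f z) = map_mx Num.conj (adjmx (grad_z f z)).
Proof.
move=> Oz; apply/colP => j; rewrite adj_grad_z // adjmxE grad_zbarE // [RHS]mxE cplx_of_realZ.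
by rewrite !cplx_conj ![2^-1 * _]mulrC.
Qed.

Lemma is_derive_grad v x j : D x ->
  is_derive x v (fun y => 2^-1 * G y 0 j) (2^-1 * (v *m jacobian G x) 0 j).
Proof.
move=> Dx; have [_ dG _] := F2.
have dv : derivable G x v by apply/diff_derivable/dG.
have /derivable_mxP/(_ 0 j) dj := dv.
have -> : (v *m jacobian G x) 0 j = 'D_v (fun y => G y 0 j) x.
  by rewrite -deriveEjacobian ?derive_mx ?[LHS]mxE //; exact: dG.
have := derivableP dj => ?.
exact: (@is_deriveZ R _ R^o (fun y => G y 0 j) 2^-1).
Qed.

(** The sign s covers both Wirtinger gradients at once: s = 1 for the adjoint of
    the gradient in z, s = -1 for that in zbar. *)
Lemma real_derive_grad (s : R) v z j (g : 'cV[C]_k -> C) : Omega z ->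
  (forall w, Omega w -> g w = (2^-1 * G (real w) 0 (lshift k j)) +i*
                              (s * (2^-1 * G (real w) 0 (rshift k j)))) ->
  real_derive v g z =
    (2^-1 * (v *m jacobian G (real z)) 0 (lshift k j)) +i*
    (s * (2^-1 * (v *m jacobian G (real z)) 0 (rshift k j))).
Proof.
move=> Oz gE; rewrite /real_derive.
have Dz : D (real z) by rewrite /= real_of_cplxK.
have near_D : \forall y \near real z, D y by apply: open_nbhs_nbhs.
congr (_ +i* _).
  rewrite (near_eq_derive (g := fun y => 2^-1 * G y 0 (lshift k j))).
    exact: (@derive_val _ _ _ _ _ _ _ (is_derive_grad v (lshift k j) Dz)).
  by apply: filterS near_D => y Dy; rewrite (gE _ Dy) cplx_of_realK.
rewrite (near_eq_derive (g := s \*: (fun y => 2^-1 * G y 0 (rshift k j) : R^o))).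
  have ? := is_derive_grad v (rshift k j) Dz.
  by rewrite derive_val.
by apply: filterS near_D => y Dy; rewrite (gE _ Dy) cplx_of_realK.
Qed.

Lemma conj_cplxE (a b : R) : Num.conj (a +i* b : C) = a +i* (-1 * b).
Proof. by rewrite cplx_conj mulN1r. Qed.

Lemma real_derive_adj_z v z j : Omega z ->
  real_derive v (fun w => adjmx (grad_z f w) j 0) z =
    cplx (2^-1 *: (v *m jacobian G (real z))) j 0.
Proof.
move=> Oz; rewrite (@real_derive_grad 1 _ _ j) //.
  by rewrite cplx_of_realZ mul1r.
by move=> w Ow; rewrite adj_grad_z // cplx_of_realZ mul1r.
Qed.

Lemma real_derive_adj_zbar v z j : Omega z ->
  real_derive v (fun w => adjmx (grad_zbar f w) j 0) z =
    Num.conj (real_derive v (fun w => adjmx (grad_z f w) j 0) z).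
Proof.
move=> Oz; rewrite real_derive_adj_z // (@real_derive_grad (-1) _ _ j) //.
  by rewrite cplx_of_realZ conj_cplxE.
by move=> w Ow; rewrite adj_grad_zbar // adj_grad_z // mxE cplx_of_realZ conj_cplxE.
Qed.

Lemma conj_half : Num.conj (2^-1 : C) = 2^-1.
Proof. by rewrite half_cplx cplx_conj oppr0. Qed.

(** For real f, the two gradients are conjugate to each other, and conjugation
    exchanges the two Wirtinger derivatives. *)
Lemma hess_zbarzbarE z : Omega z ->
  hess_zbarzbar f z = map_mx Num.conj (hess_zz f z).
Proof.
move=> Oz; apply/matrixP => j l; rewrite !mxE /partial_zbar /partial_z.
rewrite /partial_x /partial_y !real_derive_adj_zbar //.
by rewrite rmorphM rmorphB rmorphM /= conjCi conj_half mulNr opprK.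
Qed.

Lemma hess_zzbarE z : Omega z ->
  hess_zzbar f z = map_mx Num.conj (hess_zbarz f z).
Proof.
move=> Oz; apply/matrixP => j l; rewrite !mxE /partial_zbar /partial_z.
rewrite /partial_x /partial_y !real_derive_adj_zbar //.
by rewrite rmorphM rmorphD rmorphM /= conjCi conj_half mulNr.
Qed.

(** Splitting h into h and conj(h) recombines the Wirtinger derivatives into the
    real directional derivative of (grad_z f)^* along h. The factor 1/2 is that
    of (grad_z f)^* = (f_x + i f_y) / 2. *)
Lemma hess_apply z h : Omega z ->
  hess_zz f z *m h + hess_zbarz f z *m map_mx Num.conj h =
  cplx (2^-1 *: (real h *m jacobian G (real z))).
Proof.
move=> Oz; apply/colP => j; rewrite cplx_of_realZ [LHS]mxE.
rewrite [X in X + _]mxE [X in _ + X]mxE -big_split /=.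
pose J := jacobian G (real z).
have rowJ i c : ((delta_mx 0 i : 'rV[R]_(k + k)) *m J) 0 c = J i c by rewrite -rowE mxE.
pose col c := \sum_l (2^-1 * (complex.Re (h l 0) * J (lshift k l) c +
                       complex.Im (h l 0) * J (rshift k l) c)).
have colE c : (2^-1 * (real h *m J) 0 c) = col c.
  rewrite mxE big_split_ord /= -big_split mulr_sumr.
  by apply: eq_bigr => l _; rewrite real_lshift real_rshift.
rewrite !colE -cplx_sum; apply: eq_bigr => l _.
rewrite [hess_zz _ _ _ _]mxE [hess_zbarz _ _ _ _]mxE [map_mx _ _ _ _]mxE.
rewrite /partial_z /partial_zbar /partial_x /partial_y !real_derive_adj_z // !cplx_of_realZ !rowJ.
rewrite wirtinger_minus wirtinger_plus.
case: (h l 0) => a b; rewrite cplx_conj !cplxM cplxD /=.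
by congr (_ +i* _); field.
Qed.

Lemma hess_formE z h : Omega z ->
  hess_form f z h = 2^-1 * real_hess_form F (real z) (real h).
Proof.
move=> Oz; rewrite /hess_form -!mulmxA -mulmxDr hess_apply // Re_adj_mul.
by rewrite dotZr dotC.
Qed.

Hypothesis pos : forall w, Omega w -> forall h, h != 0 -> 0 < hess_form f w h.

Lemma newton_updateP z : Omega z ->
  real (newton_update f z) *m jacobian G (real z) = G (real z).
Proof.
move=> Oz; have := newton_system (pos Oz) (adjmx (grad_z f z)).
rewrite -hess_zbarzbarE // -hess_zzbarE // -adj_grad_zbar //.
rewrite -/(newton_update f z) /= hess_apply // adj_grad_z // => /(can_inj cplx_of_realK).
by apply: scalerI; rewrite invr_eq0 pnatr_eq0.
Qed.

(** Both numerator and denominator of the steplength are half of p^T H p, since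
    H p = grad F. *)
Lemma steplength_newton z : Omega z -> newton_update f z != 0 ->
  steplength f z (newton_update f z) = 1.
Proof.
move=> Oz p0; have h0 := pos Oz p0.
rewrite /steplength.
have -> : complex.Re ((grad_z f z *m newton_update f z) 0 0) =
   hess_form f z (newton_update f z).
  rewrite hess_formE // /real_hess_form newton_updateP //.
  rewrite dotE big_split_ord /= -big_split /= mulr_sumr mxE.
  set p := newton_update f z.
  have -> : \sum_j grad_z f z 0 j * p j 0 =
     \sum_j (2^-1 * (G (real z) 0 (lshift k j) * real p 0 (lshift k j) +
                    G (real z) 0 (rshift k j) * real p 0 (rshift k j)) +i*
            complex.Im (grad_z f z 0 j * p j 0)).
    apply: eq_bigr => j _; rewrite grad_zE // real_lshift real_rshift.
    case: (p j 0) => a b /=; by congr (_ +i* _); field.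
  by rewrite cplx_sum.
by rewrite divff // gt_eqF.
Qed.

Lemma stationary_gradient z : stationary_point f z -> G (real z) = 0.
Proof.
move=> [_ dz]; apply/rowP => j; rewrite !mxE.
by rewrite dz.
Qed.

End AtPoint.
End Bridge.

(** * Topology and rates in complex coordinates *)

Section Topology.
Variables (R : realType) (k : nat).
Local Notation C := (Cplx R).
Local Notation cplx := (@cplx_of_real R k).
Local Notation real := (@real_of_cplx R k).

Lemma norm_cplx_lt (a b e : R) : `|a| < e / 2 -> `|b| < e / 2 ->
  `|(a +i* b : C)| < (e%:C : C).
Proof.
move=> ae be; have e0 : 0 < e by have := normr_ge0 a; lra.
rewrite [`|_|]normc_def ltcR /= -[e](@ger0_norm _ e) ?ltW // -sqrtr_sqr.
rewrite ltr_sqrt ?exprn_gt0 // -(real_normK (num_real a)) -(real_normK (num_real b)).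
have := normr_ge0 a; have := normr_ge0 b; nra.
Qed.

Lemma norm_Re_le (x : C) (e : R) : `|x| < (e%:C : C) -> `|complex.Re x| < e.
Proof.
case: x => a b; rewrite [`|_|]normc_def ltcR; apply: le_lt_trans => /=.
by rewrite -sqrtr_sqr ler_wsqrtr // lerDl sqr_ge0.
Qed.

Lemma norm_Im_le (x : C) (e : R) : `|x| < (e%:C : C) -> `|complex.Im x| < e.
Proof.
case: x => a b; rewrite [`|_|]normc_def ltcR; apply: le_lt_trans => /=.
by rewrite -sqrtr_sqr ler_wsqrtr // lerDr sqr_ge0.
Qed.

Lemma gt0_cplx (e : C) : 0 < e -> e = (complex.Re e)%:C /\ 0 < complex.Re e.
Proof. by case: e => a b; rewrite ltcE /= => /andP[/eqP-> ?]. Qed.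

Lemma cplx_of_real_continuous : continuous cplx.
Proof.
move=> u S /= /(nbhs_ballP (cplx u)) [e /= /gt0_cplx[eE e0] eS].
have e20 : 0 < complex.Re e / 2 by rewrite divr_gt0.
apply/nbhs_ballP; exists (complex.Re e / 2) => //= v [_ uv].
apply: eS; split; first by rewrite eE ltcR.
move=> i j; rewrite !mxE /ball /= eE; apply: norm_cplx_lt.
  exact: (uv 0 (lshift k i)).
exact: (uv 0 (rshift k i)).
Qed.

Lemma real_of_cplx_continuous : continuous real.
Proof.
move=> z S /= /(nbhs_ballP (real z)) [e /= e0 eS].
have eC0 : 0 < (e%:C : C) by rewrite ltcR.
apply/(nbhs_ballP z); exists (e%:C : C) => //= w [_ zw]; apply: eS.
split => // i j; rewrite ord1 /ball /= -[j]splitK; case: (fintype.split j) => l /=.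
  rewrite !real_lshift; have := norm_Re_le (zw l 0).
  by case: (z l 0) (w l 0) => ? ? [].
rewrite !real_rshift; have := norm_Im_le (zw l 0).
by case: (z l 0) (w l 0) => ? ? [].
Qed.

Lemma convex_segment (Omega : set 'cV[C]_k) : convex_set Omega ->
  forall (x y : 'rV[R]_(k + k)) (t : R), (cplx @^-1` Omega) x ->
    (cplx @^-1` Omega) y -> 0 <= t <= 1 -> (cplx @^-1` Omega) (x + t *: (y - x)).
Proof.
move=> cO x y t Ox Oy /andP[t0 t1].
have t0C : 0 <= (t%:C : C) by rewrite lecR.
have t1C : (t%:C : C) <= 1 by rewrite (lecR t 1).
have := cO (cplx y) (cplx x) (Itv01 t0C t1C) (mem_set Oy) (mem_set Ox).
rewrite inE; congr (Omega _).
rewrite /conv /= /GRing.scale /=.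
apply/colP => j; rewrite !mxE /=.
by apply/eqP; rewrite eq_complex /=; apply/andP; split; apply/eqP; ring.
Qed.

Lemma euclid_norm_le (z : 'cV[C]_k) :
  euclid_norm z <= Num.sqrt (k + k)%:R * `|real z|.
Proof.
rewrite /euclid_norm -[`|real z|]ger0_norm // -sqrtr_sqr -sqrtrM ?ler0n //.
apply: ler_wsqrtr.
have -> : (k + k)%:R * `|real z| ^+ 2 =
  \sum_(j < k) (`|real z| ^+ 2 + `|real z| ^+ 2).
  by rewrite sumr_const card_ord mulrnDl natrD mulrDl !mulr_natl.
apply: ler_sum => j _; rewrite -real_lshift -real_rshift.
rewrite -(real_normK (num_real (real z 0 (lshift k j)))).
rewrite -(real_normK (num_real (real z 0 (rshift k j)))).
by apply: lerD; rewrite lerXn2r ?nnegrE // entry_le_norm.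
Qed.

(** The constant K is absorbed in a slightly larger ratio r < 1: eventually
    K q^n <= r^n, so that the n-th roots are at most r. *)
Lemma geometric_root_rate (z : nat -> 'cV[C]_k) zhat (K q : R) :
  0 <= q < 1 -> (forall n, euclid_norm (z n - zhat) <= K * q ^+ n) ->
  at_least_R_linear z zhat.
Proof.
case/andP=> q0 q1 Hz.
pose r := (q + 1) / 2.
have r0 : 0 < r by rewrite /r; lra.
have qr : q / r < 1 by rewrite ltr_pdivrMr // mul1r /r; lra.
have r1 : r < 1 by rewrite /r; lra.
have qr0 : 0 <= q / r by rewrite divr_ge0 // ltW.
have cg : geometric K (q / r) n @[n --> \oo] --> (0 : R).
  by apply: cvg_geometric; rewrite ger0_norm.
have [N _ HN] := cvgr_le _ cg _ ltr01.
have bound n : (maxn N 1 <= n)%N -> euclid_norm (z n - zhat) `^ n%:R^-1 <= r.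
  rewrite geq_max => /andP[Nn n1].
  have H : euclid_norm (z n - zhat) <= r ^+ n.
    apply: le_trans (Hz n) _; have := HN n Nn.
    by rewrite /geometric /= expr_div_n mulrA ler_pdivrMr ?exprn_gt0 // mul1r.
  have n0 : (n%:R : R) != 0 by rewrite pnatr_eq0 -lt0n.
  have -> : r = (r ^+ n) `^ n%:R^-1.
    by rewrite -powR_mulrn ?(ltW r0) // -powRrM divff // powRr1 // ltW.
  apply: ge0_ler_powR H; first by rewrite invr_ge0.
    by rewrite nnegrE; exact: sqrtr_ge0.
  by rewrite nnegrE exprn_ge0 // ltW.
rewrite /at_least_R_linear /root_rate.
apply: (@le_lt_trans _ _ r%:E); last by rewrite lte_fin.
rewrite /limn_esup /limf_esup.
apply: ge_ereal_inf; exists (ereal_sup [set (euclid_norm (z n - zhat) `^ n%:R^-1)%:E |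
   n in [set n | (maxn N 1 <= n)%N]]).
  by exists [set n | (maxn N 1 <= n)%N] => //; exists (maxn N 1).
by apply: ge_ereal_sup => _ [n nN <-]; rewrite lee_fin; exact: bound.
Qed.

End Topology.

(** * Convergence of the iteration *)

(** Straight segments serve as paths when the sublevel set is convex. *)
Lemma level_component_sublevel (R : realType) (k : nat)
    (Omega : set 'cV[Cplx R]_k) (f : 'cV[Cplx R]_k -> R) z0 :
  let D := @cplx_of_real R k @^-1` Omega in
  let F := f \o @cplx_of_real R k in
  (forall x y (t : R), D x /\ F x <= F (real_of_cplx z0) ->
     D y /\ F y <= F (real_of_cplx z0) -> 0 <= t <= 1 ->
     D (x + t *: (y - x)) /\ F (x + t *: (y - x)) <= F (real_of_cplx z0)) ->
  Omega z0 ->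
  [set y | D y /\ F y <= F (real_of_cplx z0)] =
  (@real_of_cplx R k) @` level_component Omega f z0.
Proof.
move=> D F cvx Oz0; apply/seteqP; split => [y [Dy Fy]|_ [w [g [_ _ <- gL]] <-]].
  exists (cplx_of_real y); last exact: cplx_of_realK.
  exists (fun t : R => cplx_of_real (real_of_cplx z0 + t *: (y - real_of_cplx z0))).
  split.
  - apply: continuous_subspaceT => t.
    apply: (@continuous_comp _ _ _ (fun t : R => real_of_cplx z0 + t *: _)
      (@cplx_of_real R k)).
      exact: continuous_line.
    exact: cplx_of_real_continuous.
  - by rewrite scale0r addr0 real_of_cplxK.
  - by rewrite scale1r addrC subrK.
  - move=> t t01; have := cvx (real_of_cplx z0) y t _ (conj Dy Fy) t01.
    rewrite /D /F /= real_of_cplxK; apply; by split.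
have [|O1 f1] := gL 1; first by rewrite ler01 lexx.
by rewrite /D /F /= !real_of_cplxK.
Qed.

Lemma cplx_of_real_step (R : realType) (k : nat) (z p : 'cV[Cplx R]_k) (a : R) :
  cplx_of_real (real_of_cplx z + a *: - real_of_cplx p) = z - a%:C *: p.
Proof. by rewrite -[RHS]real_of_cplxK real_of_cplxD real_of_cplxN real_of_cplxZ scalerN. Qed.

Theorem theorem6p1 (R : realType) (k : nat)
    (Omega : set 'cV[Cplx R]_k) (f : 'cV[Cplx R]_k -> R)
    (z p : nat -> 'cV[Cplx R]_k) (zhat : 'cV[Cplx R]_k)
    (eps : R) (omega mu gamma : nat -> R) :
  open Omega ->
  convex_set Omega ->
  twice_cont_Rdifferentiable Omega f ->
  Omega (z 0%N) ->
  compact (level_component Omega f (z 0%N)) ->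
  (forall w, Omega w -> forall h : 'cV[Cplx R]_k, h != 0 ->
    0 < hess_form f w h) ->
  level_component Omega f (z 0%N) zhat ->
  stationary_point f zhat ->
  (forall w, level_component Omega f (z 0%N) w -> stationary_point f w ->
    w = zhat) ->
  0 < eps <= 1 ->
  (forall n, p n = newton_update f (z n)) ->
  (forall n, p n != 0) ->
  (forall n, mu n = steplength f (z n) (p n)) ->
  (forall n, gamma n = relax_gamma Omega f (z n) (p n)) ->
  (forall n, 0 <= eps /\ eps <= omega n <= 2 / gamma n - eps) ->
  (forall n, z n.+1 = z n - (omega n * mu n)%:C *: p n) ->
  z @ \oo --> zhat /\ at_least_R_linear z zhat.
Proof.
move=> oO cO F2 Oz0 cL pos Lhat shat _ /andP[eps0 _] pE p0 muE gammaE omegaP zS.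
pose D := @cplx_of_real R k @^-1` Omega.
pose F := f \o @cplx_of_real R k.
have oD : open D.
  by apply: open_comp => // u _; exact: cplx_of_real_continuous.
have cD := convex_segment cO.
have posR x v : D x -> v != 0 -> 0 < real_hess_form F x v.
  move=> Dx v0; rewrite -[v](@cplx_of_realK R k) -[x](@cplx_of_realK R k).
  have := pos _ Dx (cplx_of_real v).
  rewrite (hess_formE F2 oD) // pmulr_rgt0 ?invr_gt0 //; apply.
  by rewrite -real_of_cplx_eq0 cplx_of_realK.
have LE := level_component_sublevel (sublevel_convex F2 cD posR) Oz0.
have cLR : compact [set y | D y /\ F y <= F (real_of_cplx (z 0%N))].
  rewrite LE; apply: continuous_compact => //.
  by apply: continuous_subspaceT; exact: real_of_cplx_continuous.
have OD n : D (real_of_cplx (z n)) -> Omega (z n) by rewrite /D /= real_of_cplxK.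
have Dz0 : D (real_of_cplx (z 0%N)) by rewrite /D /= real_of_cplxK.
have [K [q [K0 q01 Hq]]] : exists K q : R, [/\ 0 <= K, 0 <= q < 1 &
    forall n, `|real_of_cplx (z n) - real_of_cplx zhat| <= K * q ^+ n].
  apply: (damped_newton_geometric oD F2 cD posR cLR
    (x := fun n => real_of_cplx (z n)) (p := fun n => real_of_cplx (p n))
    (eps := eps) (omega := omega) (gamma := gamma)) => //.
  - by rewrite LE; exists zhat.
  - exact: stationary_gradient.
  - by move=> n /OD Ozn; rewrite pE; exact: (newton_updateP F2 oD pos Ozn).
  - by move=> n; rewrite real_of_cplx_eq0.
  (* the factors 1/2 cancel in the ratios, so the supremum is the same *)
  - move=> n /OD Ozn; rewrite gammaE /relax_gamma; congr sup.
    have half_ratio w (a b : R) : w = a / b -> w = (2^-1 * a) / (2^-1 * b).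
      by move=> ->; rewrite -mulf_div divff ?mul1r // invr_eq0 pnatr_eq0.
    have bE nu : below D F (real_of_cplx (z n)) (- real_of_cplx (p n)) nu <->
        Omega (z n - nu%:C *: p n) /\ f (z n - nu%:C *: p n) < f (z n).
      by rewrite /below /D /F /= cplx_of_real_step real_of_cplxK.
    have ratioE nu : Omega (z n - nu%:C *: p n) ->
        hess_form f (z n - nu%:C *: p n) (p n) / hess_form f (z n) (p n) =
        real_hess_form F (real_of_cplx (z n) + nu *: - real_of_cplx (p n)) (- real_of_cplx (p n)) /
        real_hess_form F (real_of_cplx (z n)) (- real_of_cplx (p n)).
      move=> On; rewrite !(hess_formE F2 oD) // !real_hess_formN; apply/esym/half_ratio.
      by rewrite -[z n - _]cplx_of_real_step cplx_of_realK.
    apply/seteqP; split => _ [nu [nu0 Hnu] <-];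
      have nunu : 0 < nu <= nu by [rewrite nu0 lexx]; exists nu.
    - by split => // s s0; apply/bE/Hnu.
    - by apply/esym/ratioE; exact: (Hnu _ nunu).1.
    - by split => // s s0; apply/bE/Hnu.
    - by apply/ratioE; exact: ((bE nu).1 (Hnu _ nunu)).1.
  - by move=> n; case: (omegaP n).
  - move=> n /OD Ozn; rewrite zS muE {1}pE (steplength_newton F2 oD pos Ozn) -?pE // mulr1.
    by rewrite real_of_cplxD real_of_cplxN real_of_cplxZ scalerN.
split.
  have -> : z = @cplx_of_real R k \o (fun n => real_of_cplx (z n)).
    by apply/funext => n /=; rewrite real_of_cplxK.
  rewrite -[zhat]real_of_cplxK; apply: continuous_cvg.
    exact: cplx_of_real_continuous.
  have [q0 q1] := andP q01.
  have cg : geometric K q n @[n --> \oo] --> (0 : R).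
    by apply: cvg_geometric; rewrite ger0_norm.
  apply/cvgrPdist_le => e e0; apply: filterS (cvgr_le _ cg _ e0) => n.
  by rewrite distrC; exact: le_trans.
apply: (geometric_root_rate (K := Num.sqrt (k + k)%:R * K) q01) => n.
apply: le_trans (euclid_norm_le _) _; rewrite real_of_cplxD real_of_cplxN.
by rewrite -mulrA ler_wpM2l ?sqrtr_ge0.
Qed.
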